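(* Let $A=\begin{pmatrix}1&-1\\0&1\end{pmatrix}$ and $B=\begin{pmatrix}1&0\\1&1\end{pmatrix}$. Then $SL(2,\mathbb{Z})$ and $PSL(2,\mathbb{Z})=SL(2,\mathbb{Z})/\{\pm I\}$ have the presentations $$SL(2,\mathbb{Z})=\langle A,B\mid ABA(BAB)^{-1},\ (ABABAB)^2\rangle,$$ $$PSL(2,\mathbb{Z})=\langle A,B\mid ABA(BAB)^{-1},\ ABABAB\rangle$$ (in the second, $A,B$ denote the images of these matrices in $PSL(2,\mathbb{Z})$). In particular, with $B_3=\langle a,b\mid aba=bab\rangle$ and $s=aba=bab$, the assignment $a\mapsto A$, $b\mapsto B$ induces an isomorphism $B_3/\langle s^4\rangle\simeq SL(2,\mathbb{Z})$. Moreover, the abelianizations of $SL(2,\mathbb{Z})$ and $PSL(2,\mathbb{Z})$ are cyclic, of order $12$ and $6$ respectively.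
   Context: $I$ is the $2\times2$ identity matrix. $B_3$ is Artin's braid group on three strings, given by the displayed presentation. *)

(* Defs.v *)
From HB Require Import structures.
From mathcomp Require Import all_boot all_order all_algebra.
From mathcomp Require Import boolp classical_sets functions cardinality.

Set Implicit Arguments.
Unset Strict Implicit.
Unset Printing Implicit Defensive.

Local Open Scope classical_set_scope.
Local Open Scope group_scope.

Section Subgroups.
Variable G : groupType.
Implicit Types (S H : set G) (x y : G).

Definition subgroup H := H 1 /\ forall x y, H x -> H y -> H (x / y).

Definition normal_subgroup H :=
  subgroup H /\ forall x y, H x -> H (x ^ y).

(* [smallest C S] is the intersection of all sets containing S and satisfying C. *)
Definition generated S : set G := smallest subgroup S.

Definition normal_closure S : set G := smallest normal_subgroup S.

Lemma subgroupV H x : subgroup H -> H x -> H x^-1.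
Proof. by case=> H1 HB Hx; rewrite -div1g; apply: HB. Qed.

Lemma subgroupM H x y : subgroup H -> H x -> H y -> H (x * y).
Proof.
by move=> sH Hx Hy; rewrite -(invgK y); apply: sH.2 => //; apply: subgroupV.
Qed.

Lemma generated_subgroup S : subgroup (generated S).
Proof.
split=> [H [[]]//|x y Sx Sy H HS].
by apply: HS.1.2; [exact: Sx | exact: Sy].
Qed.

Lemma normal_closure_normal S : normal_subgroup (normal_closure S).
Proof.
split=> [|x y Sx H HS]; last by apply: HS.1.2; exact: Sx.
split=> [H [[[]]]//|x y Sx Sy H HS].
by apply: HS.1.1.2; [exact: Sx | exact: Sy].
Qed.

Lemma generated_normal S :
  (forall x y, S x -> S (x ^ y)) -> normal_subgroup (generated S).
Proof.
move=> SJ; split=> [|x y]; first exact: generated_subgroup.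
pose K := [set z | generated S (z ^ y)].
apply: (@smallest_sub _ _ _ K) => [|z Sz]; last first.
  by apply: sub_gen_smallest; apply: SJ.
split=> [|z t]; rewrite /K /= ?conj1g.
  exact: (generated_subgroup S).1.
by rewrite conjMg conjVg; apply: (generated_subgroup S).2.
Qed.

End Subgroups.

Record normalSubgroup (G : groupType) := NormalSubgroup {
  nsub_set :> G -> Prop;
  nsubP : normal_subgroup nsub_set
}.

Section QuotientGroup.
Variables (G : groupType) (N : normalSubgroup G).
Implicit Types x y z : G.

Definition coset_rel : rel G := fun x y => `[< N (x^-1 * y) >].

Lemma coset_rel_refl : reflexive coset_rel.
Proof. by move=> x; apply/asboolP; rewrite mulVg; apply: (nsubP N).1.1. Qed.

Lemma coset_rel_sym : symmetric coset_rel.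
Proof.
move=> x y; apply: asbool_equiv_eq.
by split=> /(subgroupV (nsubP N).1); rewrite invgM invgK.
Qed.

Lemma coset_rel_trans : transitive coset_rel.
Proof.
move=> y x z /asboolP Nxy /asboolP Nyz; apply/asboolP.
by rewrite -(mulVKg y z) mulgA; apply: subgroupM => //; apply: (nsubP N).1.
Qed.

Canonical coset_equiv :=
  EquivRel coset_rel coset_rel_refl coset_rel_sym coset_rel_trans.

Definition quotient_group : Type := {eq_quot coset_rel}%qT.

HB.instance Definition _ := Choice.on quotient_group.
HB.instance Definition _ := EqQuotient.on quotient_group.

Definition qproj (x : G) : quotient_group := \pi_(quotient_group)%qT x.

Lemma qprojP x y : qproj x = qproj y <-> N (x^-1 * y).
Proof.
split=> [/eqmodP/asboolP //|Nxy]; apply/eqmodP; exact/asboolP.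
Qed.

Lemma qproj_repr (a : quotient_group) : qproj (repr a) = a.
Proof. exact: reprK. Qed.

Definition qone := qproj 1.
Definition qmul (a b : quotient_group) := qproj (repr a * repr b).
Definition qinv (a : quotient_group) := qproj (repr a)^-1.

Lemma qmulE x y : qmul (qproj x) (qproj y) = qproj (x * y).
Proof.
apply/qprojP.
have /qprojP Nx := qproj_repr (qproj x).
have /qprojP Ny := qproj_repr (qproj y).
set x' := repr (qproj x) in Nx *; set y' := repr (qproj y) in Ny *.
rewrite invgM.
have -> : y'^-1 * x'^-1 * (x * y) = (x'^-1 * x) ^ y' * (y'^-1 * y).
  by rewrite /conjg !mulgA mulgK.
by apply: subgroupM => //; [exact: (nsubP N).1 | exact: (nsubP N).2].
Qed.

Lemma qinvE x : qinv (qproj x) = qproj x^-1.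
Proof.
apply/qprojP.
have /qprojP Nx := qproj_repr (qproj x).
set x' := repr (qproj x) in Nx *.
rewrite invgK.
have -> : x' * x^-1 = (x'^-1 * x)^-1 ^ (x'^-1).
  by rewrite /conjg invgM !invgK !mulgA mulgK.
by apply: (nsubP N).2; apply: subgroupV => //; exact: (nsubP N).1.
Qed.

Lemma qmulA : associative qmul.
Proof.
move=> a b c; rewrite -(qproj_repr a) -(qproj_repr b) -(qproj_repr c).
by rewrite !qmulE mulgA.
Qed.

Lemma qmul1 : left_id qone qmul.
Proof. by move=> a; rewrite -(qproj_repr a) qmulE mul1g. Qed.

Lemma q1mul : right_id qone qmul.
Proof. by move=> a; rewrite -(qproj_repr a) qmulE mulg1. Qed.

Lemma qmulV : left_inverse qone qinv qmul.
Proof. by move=> a; rewrite -(qproj_repr a) qinvE qmulE mulVg. Qed.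

Lemma qVmul : right_inverse qone qinv qmul.
Proof. by move=> a; rewrite -(qproj_repr a) qinvE qmulE mulgV. Qed.

HB.instance Definition _ :=
  isGroup.Build quotient_group qmulA qmul1 q1mul qmulV qVmul.

Lemma qprojM : {morph qproj : x y / x * y}.
Proof. by move=> x y; rewrite -qmulE. Qed.

HB.instance Definition _ := isMultiplicative.Build G quotient_group qproj qprojM.

End QuotientGroup.

(* Free groups, as reduced words: the letter (x, false) stands for x and
   (x, true) for its inverse. *)
Section FreeGroup.
Variable X : choiceType.
Implicit Types (l m : X * bool) (u v w : seq (X * bool)).

Definition linv l : X * bool := (l.1, ~~ l.2).

Definition reduced w := sorted [rel l m | m != linv l] w.

Record free_group := FreeGroup { word : seq (X * bool); _ : reduced word }.

HB.instance Definition _ := [isSub for word].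
HB.instance Definition _ := [Choice of free_group by <:].

Definition push l w := if ohead w == Some (linv l) then behead w else l :: w.

Lemma linvK : involutive linv.
Proof. by case=> x b; rewrite /linv /= negbK. Qed.

Lemma reduced_push l w : reduced w -> reduced (push l w).
Proof.
rewrite /push; case: w => //= m w rw.
case: eqVneq => [_|ne]; first exact: path_sorted rw.
by rewrite /= rw andbT; apply: contra_neq ne => ->.
Qed.

Lemma pushK l w : reduced w -> push l (push (linv l) w) = w.
Proof.
rewrite /push linvK; case: w => [|m w] /=; first by rewrite eqxx.
case: (eqVneq (Some m)) => [[->]|_] rw; last by rewrite /= eqxx.
case: w rw => [|k w] //= /andP[kl _].
by rewrite (inj_eq Some_inj) (negbTE kl).
Qed.

Lemma reduced_foldr_push u v : reduced v -> reduced (foldr push v u).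
Proof. by move=> rv; elim: u => //= l u; apply: reduced_push. Qed.

Lemma foldr_push l u v : reduced v ->
  foldr push v (push l u) = push l (foldr push v u).
Proof.
move=> rv; rewrite [push l u]/push; case: u => //= m u.
case: eqP => // -[->]; rewrite pushK //.
exact: reduced_foldr_push.
Qed.

Lemma foldr_push_nil u : reduced u -> foldr push [::] u = u.
Proof.
elim: u => //= l u IHu ru; rewrite IHu; last exact: path_sorted ru.
rewrite /push; case: u ru {IHu} => //= m u /andP[ml _].
by rewrite (inj_eq Some_inj) (negbTE ml).
Qed.

Lemma reduced_inv u : reduced u -> reduced (rev (map linv u)).
Proof.
rewrite /reduced rev_sorted sorted_map; apply: sub_sorted => l m /=.
by apply: contra_neq => ->; rewrite linvK.
Qed.

Definition free_mul (u v : free_group) : free_group :=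
  FreeGroup (reduced_foldr_push (word u) (valP v)).
Definition free_one : free_group := @FreeGroup [::] isT.
Definition free_inv (u : free_group) : free_group :=
  FreeGroup (reduced_inv (valP u)).

Lemma free_mulA : associative free_mul.
Proof.
move=> [u ru] [v rv] [w rw]; apply/val_inj => /=.
by elim: u {ru} => //= l u ->; rewrite foldr_push.
Qed.

Lemma free_mul1 : left_id free_one free_mul.
Proof. by move=> u; apply/val_inj. Qed.

Lemma free_1mul : right_id free_one free_mul.
Proof. by move=> [u ru]; apply/val_inj; apply: foldr_push_nil. Qed.

Lemma free_mulV : left_inverse free_one free_inv free_mul.
Proof.
move=> [u ru]; apply/val_inj => /=.
elim: u {ru} => //= l u IHu.
by rewrite rev_cons foldr_rcons /push /= linvK eqxx.
Qed.

Lemma free_invK : involutive free_inv.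
Proof.
move=> [u ru]; apply/val_inj => /=.
by rewrite map_rev revK mapK //; apply: linvK.
Qed.

Lemma free_Vmul : right_inverse free_one free_inv free_mul.
Proof. by move=> u; rewrite -{1}(free_invK u) free_mulV. Qed.

HB.instance Definition _ :=
  isGroup.Build free_group free_mulA free_mul1 free_1mul free_mulV free_Vmul.

Definition fgen (x : X) : free_group := @FreeGroup [:: (x, false)] isT.

Lemma free_group_ind (H : set free_group) :
  subgroup H -> (forall x, H (fgen x)) -> forall g, H g.
Proof.
move=> sH Hgen [u ru]; elim: u ru => [|[x b] u IHu] ru.
  by rewrite (_ : FreeGroup ru = 1); [exact: sH.1 | exact: val_inj].
have ru' : reduced u by exact: path_sorted ru.
rewrite (_ : FreeGroup ru =
  (if b then (fgen x)^-1 else fgen x) * FreeGroup ru').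
  apply: subgroupM => //.
  by case: b {ru}; [apply: subgroupV|].
apply/val_inj; case: b ru => ru /=; rewrite /push.
  case: u ru ru' {IHu} => //= m u /andP[ml _] _.
  by rewrite (inj_eq Some_inj) (negbTE ml).
case: u ru ru' {IHu} => //= m u /andP[ml _] _.
by rewrite (inj_eq Some_inj) (negbTE ml).
Qed.

End FreeGroup.

Section Presentation.
Variables (X : choiceType) (R : set (free_group X)).

Definition relations := NormalSubgroup (normal_closure_normal R).

Definition presented_group := quotient_group relations.

Definition pgen (x : X) : presented_group := qproj relations (fgen x).

(* G = <X | R>, where the generator x of the presentation denotes g x in G. *)
Definition has_presentation (G : groupType) (g : X -> G) :=
  exists f : {multiplicative presented_group -> G},
    bijective f /\ forall x, f (pgen x) = g x.

Lemma presented_group_ind (H : set presented_group) :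
  subgroup H -> (forall x, H (pgen x)) -> forall a, H a.
Proof.
move=> sH Hgen a; rewrite -(qproj_repr a).
apply: (@free_group_ind X (qproj relations @^-1` H)) => //; split.
  exact: sH.1.
move=> u v Hu Hv; rewrite /preimage /= qprojM.
by rewrite -qinvE; apply: sH.2.
Qed.

End Presentation.

Definition fa : free_group 'I_2 := fgen ord0.
Definition fb : free_group 'I_2 := fgen ord_max.
Definition braid_relator := fa * fb * fa * (fb * fa * fb)^-1.

Definition B3 := presented_group [set braid_relator].

Definition ba : B3 := pgen _ ord0.
Definition bb : B3 := pgen _ ord_max.
Definition bs : B3 := ba * bb * ba.

Lemma bsE : bs = bb * ba * bb.
Proof.
have : qproj (relations [set braid_relator]) (fb * fa * fb) =
       qproj (relations [set braid_relator]) (fa * fb * fa).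
  apply/qprojP.
  have -> : (fb * fa * fb)^-1 * (fa * fb * fa) =
      braid_relator ^ (fb * fa * fb).
    by rewrite /conjg /braid_relator mulgVK.
  by apply: (normal_closure_normal _).2; apply: sub_gen_smallest.
by rewrite !qprojM => /esym.
Qed.

Lemma bs4_central (x : B3) : (bs ^+ 4) ^ x = bs ^+ 4.
Proof.
apply/conjg_fixP/commgP; apply/commute_sym.
have sa : bs * ba = bb * bs by rewrite {1}bsE /bs !mulgA.
have sb : bs * bb = ba * bs by rewrite {2}bsE /bs !mulgA.
apply: (@presented_group_ind _ _ [set x : B3 | commute x (bs ^+ 4)]).
  split=> [|y z] /=; first exact/commute_sym/commute1.
  move=> cy cz; apply: commute_sym; apply: commuteM; first exact: commute_sym.
  exact/commuteV/commute_sym.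
have s2a : commute ba (bs ^+ 2).
  by rewrite /commute expgS expg1 mulgA -sb -mulgA -sa mulgA.
have s2b : commute bb (bs ^+ 2).
  by rewrite /commute expgS expg1 mulgA -sa -mulgA -sb mulgA.
move=> i; rewrite /= (expgnA bs 2 2); apply: commuteX.
by case: i => [[|[|//]]] p; [have -> : Ordinal p = ord0 by exact: val_inj
  | have -> : Ordinal p = ord_max by exact: val_inj].
Qed.

Lemma bs4_normal : normal_subgroup (generated [set bs ^+ 4]).
Proof.
by apply: generated_normal => x y -> /=; rewrite bs4_central.
Qed.

(* <s^4>, the subgroup generated by s^4; it is normal because s^2 is central. *)
Definition bs4_subgroup := NormalSubgroup bs4_normal.

Section SL2Z.
Local Open Scope ring_scope.
Import GRing.Theory.

Record SL2Z := MkSL2Z { slmx : 'M[int]_2; _ : \det slmx == 1 }.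

HB.instance Definition _ := [isSub for slmx].
HB.instance Definition _ := [Choice of SL2Z by <:].

Lemma SL2Z_mul_subproof (M N : SL2Z) : \det (slmx M *m slmx N) == 1.
Proof. by rewrite det_mulmx (eqP (valP M)) (eqP (valP N)) mulr1. Qed.

Lemma SL2Z_one_subproof : \det (1%:M : 'M[int]_2) == 1.
Proof. by rewrite det1. Qed.

Lemma SL2Z_inv_subproof (M : SL2Z) : \det (\adj (slmx M)) == 1.
Proof.
have /eqP := det_mulmx (slmx M) (\adj (slmx M)).
by rewrite mul_mx_adj (eqP (valP M)) det1 mul1r eq_sym.
Qed.

Definition SL2Z_mul (M N : SL2Z) : SL2Z := MkSL2Z (SL2Z_mul_subproof M N).
Definition SL2Z_one : SL2Z := MkSL2Z SL2Z_one_subproof.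
Definition SL2Z_inv (M : SL2Z) : SL2Z := MkSL2Z (SL2Z_inv_subproof M).

Lemma SL2Z_mulA : associative SL2Z_mul.
Proof. by move=> M N P; apply/val_inj; apply: mulmxA. Qed.

Lemma SL2Z_mul1 : left_id SL2Z_one SL2Z_mul.
Proof. by move=> M; apply/val_inj; apply: mul1mx. Qed.

Lemma SL2Z_1mul : right_id SL2Z_one SL2Z_mul.
Proof. by move=> M; apply/val_inj; apply: mulmx1. Qed.

Lemma SL2Z_mulV : left_inverse SL2Z_one SL2Z_inv SL2Z_mul.
Proof.
by move=> M; apply/val_inj; rewrite /= mul_adj_mx (eqP (valP M)).
Qed.

Lemma SL2Z_Vmul : right_inverse SL2Z_one SL2Z_inv SL2Z_mul.
Proof.
by move=> M; apply/val_inj; rewrite /= mul_mx_adj (eqP (valP M)).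
Qed.

HB.instance Definition _ :=
  isGroup.Build SL2Z SL2Z_mulA SL2Z_mul1 SL2Z_1mul SL2Z_mulV SL2Z_Vmul.

Definition mx22 (a b c d : int) : 'M[int]_2 :=
  \matrix_(i, j) if i == 0 then (if j == 0 then a else b)
                 else (if j == 0 then c else d).

Lemma det_mx22 a b c d : \det (mx22 a b c d) = a * d - b * c.
Proof.
rewrite (expand_det_row _ 0) !big_ord_recl big_ord0 /= /cofactor.
by rewrite !det_mx11 !mxE /= expr0 expr1 mul1r mulN1r mulrN addr0.
Qed.

Lemma SL2Z_A_subproof : \det (mx22 1 (- 1) 0 1) == 1.
Proof. by rewrite det_mx22. Qed.

Lemma SL2Z_B_subproof : \det (mx22 1 0 1 1) == 1.
Proof. by rewrite det_mx22. Qed.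

Definition slA : SL2Z := MkSL2Z SL2Z_A_subproof.
Definition slB : SL2Z := MkSL2Z SL2Z_B_subproof.

Definition pm_id : set SL2Z := [set M | slmx M = 1%:M \/ slmx M = - 1%:M].

Lemma pm_id_normal : normal_subgroup pm_id.
Proof.
have central (M N : SL2Z) : pm_id M -> (M ^ N)%g = M.
  move=> pmM; rewrite /conjg.
  suff -> : (M * N = N * M)%g by rewrite mulKg.
  apply/val_inj; case: pmM => /= ->; rewrite ?mulmx1 ?mul1mx //.
  by rewrite mulmxN mulNmx mulmx1 mul1mx.
split=> [|M N pmM]; last by rewrite central.
split=> [|M N pmM pmN]; first by left.
have NN : slmx N *m slmx N = 1%:M.
  by case: pmN => ->; rewrite ?mulmxN ?mulNmx ?opprK mulmx1.
have -> : (N^-1)%g = N.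
  apply: (@mulgI _ N); rewrite mulgV; apply/val_inj; exact/esym.
rewrite /pm_id /=.
case: pmM => ->; rewrite ?mulNmx mul1mx; case: pmN => ->; rewrite ?opprK; auto.
Qed.

Definition pm_id_subgroup := NormalSubgroup pm_id_normal.

Definition PSL2Z := quotient_group pm_id_subgroup.

Definition pslA : PSL2Z := qproj pm_id_subgroup slA.
Definition pslB : PSL2Z := qproj pm_id_subgroup slB.

End SL2Z.

Section Abelianization.
Variable G : groupType.

Definition commutators : set G := [set z | exists x y, z = [~ x, y]].

Lemma derived_normal : normal_subgroup (generated commutators).
Proof.
apply: generated_normal => z t [x [y ->]].
by exists (x ^ t), (y ^ t); rewrite conjRg.
Qed.

Definition derived_subgroup := NormalSubgroup derived_normal.

Definition abelianization := quotient_group derived_subgroup.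

End Abelianization.

Definition cyclic_of_order (G : groupType) (n : nat) :=
  (exists g : G, forall x : G, exists k : nat, x = g ^+ k \/ x = g ^- k)
  /\ ([set: G] #= `I_n)%card.

(* Main.v *)
Require Import Defs.
From HB Require Import structures.
From mathcomp Require Import all_boot all_order all_algebra.
From mathcomp Require Import boolp classical_sets functions cardinality.
From mathcomp Require Import zify ring.

(** Let a group G be generated by a and b with aba = bab = s and s^4 = 1.
    Conjugation by s exchanges a and b, and s^2 is central, so every element of
    G can be brought to the form s^i w s^j, where w is a word in the letters
    a^-1 and b, without their inverses (normal_formP).  For G = SL(2,Z) these
    two letters are the elementary matrices

      A^-1 = (1 1; 0 1)  and  B = (1 0; 1 1),

    and S = ABA = (0 -1; 1 0) is a rotation of order 4.  A product of these
    elementary matrices has nonnegative entries, and its off-diagonal entries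
    add up to at least the length of the product (posword_mx); therefore it is
    a power of S only if it is empty (posword_powS).

    Consequently, if G is sent to SL(2,Z), or to PSL(2,Z), with a and b going
    to A and B, an element s^i w s^j of the kernel has w empty: it is a power
    of s that is trivial already in the target (braided_kernel).  Since S has
    order 4 in SL(2,Z) and order 2 in PSL(2,Z), the relation s^4 = 1,
    respectively s^2 = 1, makes the kernel trivial.  Surjectivity is the
    Euclidean algorithm on the first column of a matrix (SL2Z_generated).
    The resulting criteria SL2Z_bijective and PSL2Z_bijective apply to the
    presented groups, where ababab = s^2, and to B_3/<s^4>.

    In the abelianization the braid relation identifies a with b, so that
    s^m = 1 becomes a^(3m) = 1 and the group is cyclic of order at most 3m.
    The order is exactly 3m because the presentation allows a map to Z/3m
    sending both generators to 1 (cyclic_abelianization). *)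

Set Implicit Arguments.
Unset Strict Implicit.
Unset Printing Implicit Defensive.

Local Open Scope classical_set_scope.
Local Open Scope group_scope.

(** * Morphisms of groups and generators *)

Section MultiplicativeTheory.
Variables (G H : groupType) (f : {multiplicative G -> H}).

Lemma multiplicative1 : f 1 = 1.
Proof. by apply: (@mulgI _ (f 1)); rewrite -gmulfM !mulg1. Qed.

(** The general rules for inverses, powers and commutators ask for morphisms
    that preserve 1 by structure; between groups this is automatic. *)
Definition umagma_of_multiplicative : UMagmaMorphism.type G H :=
  HB.pack_for (UMagmaMorphism.type G H) (Multiplicative.sort f)
    (Multiplicative_isUMagmaMorphism.Build G H f multiplicative1).

Lemma multiplicativeV : {morph f : x / x^-1}.
Proof. exact: (gmulfV umagma_of_multiplicative). Qed.

Lemma multiplicativeF : {morph f : x y / x / y}.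
Proof. exact: (gmulfF umagma_of_multiplicative). Qed.

Lemma multiplicativeX n : {morph f : x / x ^+ n}.
Proof. exact: (gmulfXn umagma_of_multiplicative). Qed.

Lemma multiplicativeJ : {morph f : x y / x ^ y}.
Proof. exact: (gmulfJ umagma_of_multiplicative). Qed.

Lemma multiplicativeR : {morph f : x y / [~ x, y]}.
Proof. exact: (gmulfR umagma_of_multiplicative). Qed.

Lemma multiplicative_inj : (forall x, f x = 1 -> x = 1) -> injective f.
Proof. exact: (@gmulf_inj _ _ umagma_of_multiplicative). Qed.

End MultiplicativeTheory.

Lemma morph_multiplicative (G H : groupType) (f : G -> H) :
  {morph f : x y / x * y} -> exists F : {multiplicative G -> H}, F =1 f.
Proof.
move=> fM; pose mM := isMultiplicative.Build G H f fM.
by exists (HB.pack_for {multiplicative G -> H} f mM).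
Qed.

Lemma generated2_ind (G : groupType) (H : set G) (a b x : G) :
  subgroup H -> H a -> H b -> generated [set a; b] x -> H x.
Proof. by move=> sH Ha Hb; apply; split=> // y [->|->]. Qed.

Section Morphisms.
Variables G H : groupType.

Implicit Type f : {multiplicative G -> H}.

Lemma subgroup_preimage f (K : set H) : subgroup K -> subgroup (f @^-1` K).
Proof.
move=> [K1 KF]; split=> [|x y Kx Ky]; rewrite /preimage /=.
  by rewrite multiplicative1.
by rewrite multiplicativeF; apply: KF.
Qed.

Lemma kernel_normal f : normal_subgroup (f @^-1` [set 1]).
Proof.
split=> [|x y]; rewrite /preimage /=.
  apply: (subgroup_preimage f (K := [set 1])).
  by split=> // x y -> ->; rewrite /= divg1.
by rewrite multiplicativeJ => ->; rewrite conj1g.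
Qed.

Lemma generated_morph f (a b x : G) :
  generated [set a; b] x -> generated [set f a; f b] (f x).
Proof.
pose K := f @^-1` generated [set f a; f b].
move=> gx; apply: (generated2_ind (H := K) _ _ _ gx).
- exact/subgroup_preimage/generated_subgroup.
- by apply: sub_gen_smallest; left.
- by apply: sub_gen_smallest; right.
Qed.

Lemma bijective_of_generators f (a b : G) :
  (forall x, f x = 1 -> x = 1) ->
  (forall y, generated [set f a; f b] y) -> bijective f.
Proof.
move=> f1 gen; have fI : injective f := multiplicative_inj f1.
have fS y : exists x, f x = y.
  apply: (generated2_ind (H := [set z | exists x, f x = z]) _ _ _ (gen y)).
  - split=> [|_ _ [x <-] [x' <-]]; first by exists 1; rewrite multiplicative1.
    by exists (x / x'); rewrite multiplicativeF.
  - by exists a.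
  - by exists b.
have [g fK] := choice fS.
by exists g => // x; apply: fI.
Qed.

Lemma quotient_lift (N : normalSubgroup G) f : (forall x, N x -> f x = 1) ->
  exists F : {multiplicative quotient_group N -> H},
    forall x, F (qproj N x) = f x.
Proof.
move=> fN; pose F (c : quotient_group N) := f (repr c).
have FE x : F (qproj N x) = f x.
  have /qprojP Nx := qproj_repr (qproj N x).
  by rewrite -[LHS]invgK; apply/mulg1_eq; rewrite -multiplicativeV -gmulfM fN.
have FM : {morph F : c d / c * d}.
  move=> c d; rewrite -(qproj_repr c) -(qproj_repr d) -qprojM !FE.
  exact: gmulfM.
have [F' F'E] := @morph_multiplicative (quotient_group N) H F FM.
by exists F' => x; rewrite F'E FE.
Qed.

End Morphisms.

(** * Universal property of presented groups *)

Section Presentations.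
Variables (X : choiceType) (G : groupType) (g : X -> G).

Definition letter_eval (l : X * bool) := if l.2 then (g l.1)^-1 else g l.1.

Definition free_eval (u : free_group X) : G :=
  foldr (fun l x => letter_eval l * x) 1 (word u).

(** The product of reduced words is computed by pushing letters one at a time;
    pushing may cancel a letter against its inverse, which does not change the
    value in the group. *)
Lemma free_evalM : {morph free_eval : u v / u * v}.
Proof.
have evalV l : letter_eval (linv l) = (letter_eval l)^-1.
  by case: l => x []; rewrite /letter_eval /= ?invgK.
move=> [u ru] [v rv]; rewrite /free_eval /=.
elim: u {ru} => [|l u IHu] /=; first by rewrite mul1g.
rewrite -mulgA -IHu /push; set w := foldr (@push X) v u.
case: w => [|m w] //=; case: eqP => [[->]|_] //=.
by rewrite evalV mulVKg.
Qed.

HB.instance Definition _ :=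
  isMultiplicative.Build (free_group X) G free_eval free_evalM.

Lemma free_eval_gen x : free_eval (fgen x) = g x.
Proof. by rewrite /free_eval /= mulg1. Qed.

Lemma presented_lift (R : set (free_group X)) :
  (forall r, R r -> free_eval r = 1) ->
  exists f : {multiplicative presented_group R -> G},
    forall x, f (pgen R x) = g x.
Proof.
move=> R1; have NR u : relations R u -> free_eval u = 1.
  exact: (smallest_sub (kernel_normal free_eval)).
have [f fE] := quotient_lift (f := free_eval) NR.
by exists f => x; rewrite fE /= free_eval_gen.
Qed.

End Presentations.

Lemma presentation_lift (X : choiceType) (R : set (free_group X))
    (G K : groupType) (g : X -> G) (h : X -> K) :
  has_presentation R g -> (forall r, R r -> free_eval h r = 1) ->
  exists f : {multiplicative G -> K}, forall x, f (g x) = h x.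
Proof.
move=> [p [[q pK qK] pE]] R1; have [f fE] := presented_lift R1.
have [q' q'E] :=
  @morph_multiplicative G (presented_group R) q (can2_gmulfM pK qK).
by exists (f \o q') => x; rewrite /= q'E -pE pK fE.
Qed.

Section TwoGenerators.
Variable R : set (free_group 'I_2).

Lemma presented_generated x : generated [set pgen R ord0; pgen R ord_max] x.
Proof.
apply: (@presented_group_ind _ R) => [|i]; first exact: generated_subgroup.
apply: sub_gen_smallest.
by case: i => [[|[|//]]] p; [left | right]; congr pgen; apply: val_inj.
Qed.

Lemma presentation_generated (G : groupType) (a b x : G) :
  has_presentation R (tnth [tuple a; b]) -> generated [set a; b] x.
Proof.
move=> [f [[h _ hK] fE]]; rewrite -(hK x).
have /= := generated_morph (f := f) (presented_generated (h x)).
by rewrite !fE !(tnth_nth a).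
Qed.

Lemma presented_relator r : R r -> qproj (relations R) r = 1.
Proof.
move=> Rr; apply/esym/qprojP; rewrite invg1 mul1g.
exact: sub_gen_smallest.
Qed.

Lemma presented_braid : R braid_relator ->
  pgen R ord0 * pgen R ord_max * pgen R ord0 =
  pgen R ord_max * pgen R ord0 * pgen R ord_max.
Proof.
move=> /presented_relator; rewrite /braid_relator !(gmulfM, multiplicativeV).
by move=> /divg1_eq sE; exact: sE.
Qed.

End TwoGenerators.

(** * Normal form in braided two-generator groups *)

Section NormalForm.
Variables (G : groupType) (a b s : G).

(** The positive letters are a^-1 and b because in SL(2,Z) these are the
    elementary matrices with nonnegative entries. *)
Definition letter (l : bool) := if l then b else a^-1.

Definition posword (w : seq bool) := \prod_(l <- w) letter l.

Definition normal_form i w j := s ^+ i * posword w * s ^+ j.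

Lemma posword_cons l w : posword (l :: w) = letter l * posword w.
Proof. exact: big_cons. Qed.

Hypotheses (sA : a * b * a = s) (sB : b * a * b = s).

Lemma letter_s l : letter l * s = s * (letter (~~ l))^-1.
Proof.
case: l; rewrite /letter /= ?invgK; first by rewrite -{1}sA -sB !mulgA.
by rewrite -{1}sA -sB mulgK -mulgA mulKg.
Qed.

Lemma letterV_s l : (letter l)^-1 * s = s * letter (~~ l).
Proof.
by apply: (@mulgI _ (letter l)); rewrite mulVKg mulgA letter_s mulgVK.
Qed.

Hypothesis s4 : s ^+ 4 = 1.

Lemma sV : s^-1 = s ^+ 3.
Proof. by apply: mulg1_eq; rewrite -expgS. Qed.

(** A quotient of the two distinct letters is a positive letter up to a power
    of s: ab = s a^-1 and b^-1 a^-1 = s^-1 b.  This is the step that removes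
    inverses from a word. *)
Lemma letterVN l :
  (letter (~~ l))^-1 * letter l = s ^+ (if l then 1 else 3)%N * letter (~~ l).
Proof.
case: l; rewrite /letter /= ?invgK; first by rewrite expg1 -sA mulgK.
by rewrite -sV -sB !invgM -!mulgA mulVg mulg1.
Qed.

Let NF : set G := [set x | exists i w j, x = normal_form i w j].

Let NF_s x n : NF x -> NF (s ^+ n * x).
Proof.
move=> [i [w [j ->]]]; exists (n + i)%N, w, j.
by rewrite /normal_form !mulgA -expgnDr.
Qed.

(** Even powers of s are central, so only the letter in front of w or of s w
    matters.  Moving a letter past s turns it into the inverse of the other
    letter, which cancels the head of w, or combines with it by letterVN, or,
    when w is empty, is moved past the final power of s. *)
Let NF_letter l x : NF x -> NF (letter l * x).
Proof.
have NF0 w j : NF (posword w * s ^+ j).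
  by exists 0, w, j; rewrite /normal_form mul1g.
have ls2 : letter l * s ^+ 2 = s ^+ 2 * letter l.
  by rewrite expg2 mulgA letter_s -mulgA letterV_s negbK mulgA.
move=> [i [w [j ->]]]; rewrite /normal_form -mulgA.
elim/ltn_ind: i => -[_|[_|i IHi]].
- by rewrite mul1g mulgA -posword_cons; apply: NF0.
- rewrite expg1 [letter l * _]mulgA letter_s -mulgA; apply: (NF_s 1).
  case: w => [|l' w].
    have -> : (letter (~~ l))^-1 * (posword [::] * s ^+ j) =
              s ^+ 3 * (posword [:: l] * s ^+ j.+1).
      rewrite /posword big_nil big_seq1 mul1g -sV expgS.
      by rewrite [letter l * _]mulgA letter_s -[s / _ * _]mulgA mulKg.
    exact/NF_s/NF0.
  rewrite posword_cons -mulgA [_^-1 * _]mulgA; case: (eqVneq l' l) => [->|l'l].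
    rewrite letterVN -mulgA; apply: NF_s.
    by rewrite mulgA -posword_cons; apply: NF0.
  have -> : l' = ~~ l by case: l l' l'l {ls2} => [] [].
  by rewrite mulVg mul1g; apply: NF0.
- rewrite -[i.+2]/(2 + i)%N expgnDr -mulgA [letter l * _]mulgA ls2 -mulgA.
  by apply/NF_s/IHi.
Qed.

Lemma normal_formP x : generated [set a; b] x ->
  exists i w j, x = normal_form i w j.
Proof.
move=> gx.
(* Closure under the inverse is built in, so that the elements preserving the
   normal forms by left multiplication form a subgroup. *)
have closed : subgroup
    [set y | forall z, (NF z -> NF (y * z)) /\ (NF z -> NF (y^-1 * z))].
  split=> [z|y y' Hy Hy' z]; first by rewrite invg1 mul1g.
  rewrite invgF -!mulgA.
  by split=> [/(Hy' _).2/(Hy _).1|/(Hy _).2/(Hy' _).1].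
have sP y : NF y -> NF (s * y) by apply: (NF_s 1).
have sVP y : NF y -> NF (s^-1 * y) by rewrite sV; apply: NF_s.
have lVP l y : NF y -> NF ((letter l)^-1 * y).
  move=> Ny; have -> : (letter l)^-1 = s^-1 * letter (~~ l) * s.
    by rewrite -mulgA letter_s negbK mulKg.
  by rewrite -!mulgA; apply/sVP/NF_letter/sP.
have /= [z|z|Nx _] := generated2_ind closed _ _ gx 1.
- split=> Nz; last exact: (NF_letter false).
  by rewrite -[a]invgK; apply: (lVP false).
- by split=> Nz; [apply: (NF_letter true) | apply: (lVP true)].
- rewrite -[x]mulg1; apply: Nx.
  by exists 0, [::], 0; rewrite /normal_form /posword big_nil !mulg1.
Qed.

End NormalForm.

Lemma normal_form_morph (G H : groupType) (f : {multiplicative G -> H})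
    (a b s : G) i w j :
  f (normal_form a b s i w j) = normal_form (f a) (f b) (f s) i w j.
Proof.
rewrite /normal_form !gmulfM !multiplicativeX; congr (_ * _ * _).
rewrite /posword (big_morph f (gmulfM (s := f)) (multiplicative1 f)).
by apply: eq_bigr => -[] _; rewrite /letter //= multiplicativeV.
Qed.

(** * Integer matrices *)

Section Matrices.
Local Open Scope ring_scope.
Import GRing.Theory Num.Theory Order.TTheory.
Implicit Types (a b c d : int) (M N : SL2Z).

Lemma mx22_mul a b c d a' b' c' d' :
  mx22 a b c d *m mx22 a' b' c' d' =
  mx22 (a * a' + b * c') (a * b' + b * d') (c * a' + d * c') (c * b' + d * d').
Proof.
apply/matrixP => i j; rewrite !mxE !big_ord_recl big_ord0 !mxE /= addr0.
by case: (i == 0); case: (j == 0).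
Qed.

Lemma mx22_scalar a : a%:M = mx22 a 0 0 a.
Proof. by apply/matrixP => -[[|[|//]] p] [[|[|//]] q]; rewrite !mxE. Qed.

Lemma mx22_N1 : - 1%:M = mx22 (- 1) 0 0 (- 1).
Proof. by apply/matrixP => -[[|[|//]] p] [[|[|//]] q]; rewrite !mxE. Qed.

Lemma mx22_eta (M : 'M[int]_2) : M = mx22 (M 0 0) (M 0 1) (M 1 0) (M 1 1).
Proof.
apply/matrixP => -[[|[|//]] p] [[|[|//]] q]; rewrite !mxE /=;
  congr (M _ _); exact: val_inj.
Qed.

Lemma mx22_inj a b c d a' b' c' d' :
  mx22 a b c d = mx22 a' b' c' d' -> [/\ a = a', b = b', c = c' & d = d'].
Proof.
move=> /matrixP E; have := E 0 0; have := E 0 1; have := E 1 0; have := E 1 1.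
by rewrite !mxE.
Qed.

Lemma slmxM M N : slmx (M * N)%g = slmx M *m slmx N.
Proof. by []. Qed.

Lemma slmx_invA : slmx (slA^-1)%g = mx22 1 1 0 1.
Proof.
have d1 : \det (mx22 1 1 0 1) == 1 by rewrite det_mx22.
suff -> : (slA^-1)%g = MkSL2Z d1 by [].
by apply: mulg1_eq; apply: val_inj; rewrite /= mx22_mul [RHS]mx22_scalar.
Qed.

Lemma slmx_invB : slmx (slB^-1)%g = mx22 1 0 (- 1) 1.
Proof.
have d1 : \det (mx22 1 0 (- 1) 1) == 1 by rewrite det_mx22.
suff -> : (slB^-1)%g = MkSL2Z d1 by [].
by apply: mulg1_eq; apply: val_inj; rewrite /= mx22_mul [RHS]mx22_scalar.
Qed.

Definition slS : SL2Z := (slA * slB * slA)%g.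

Lemma slmxS : slmx slS = mx22 0 (- 1) 1 0.
Proof. by rewrite /slS !slmxM /= !mx22_mul. Qed.

Lemma slS_braid : (slB * slA * slB)%g = slS.
Proof. by apply: val_inj; rewrite /= !mx22_mul. Qed.

Lemma slS4 : (slS ^+ 4)%g = 1%g.
Proof. by apply: val_inj; rewrite /= !mx22_mul [RHS]mx22_scalar. Qed.

Lemma slS_mod4 n : (slS ^+ n)%g = (slS ^+ (n %% 4))%g.
Proof.
by rewrite {1}(divn_eq n 4) expgnDr mulnC expgnA slS4 expg1n mul1g.
Qed.

Lemma slmxSX n : slmx (slS ^+ n)%g =
  nth 0 [:: mx22 1 0 0 1; mx22 0 (- 1) 1 0;
            mx22 (- 1) 0 0 (- 1); mx22 0 1 (- 1) 0] (n %% 4)%N.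
Proof.
rewrite slS_mod4; have : (n %% 4 < 4)%N by rewrite ltn_mod.
by case: (n %% 4)%N => [|[|[|[|//]]]] _; rewrite /= ?mx22_mul -?mx22_scalar.
Qed.

Lemma slS_pm_id n : pm_id (slS ^+ n)%g -> ~~ odd n.
Proof.
rewrite /pm_id /= slmxSX mx22_N1 mx22_scalar.
have : (n %% 4 < 4)%N by rewrite ltn_mod.
case E : (n %% 4)%N => [|[|[|[|//]]]] _ /=;
  rewrite (divn_eq n 4) E oddD oddM andbF //=.
- by case=> /mx22_inj[].
- by case=> /mx22_inj[].
Qed.

Lemma slS_eq1 n : (slS ^+ n)%g = 1%g -> (4 %| n)%N.
Proof.
move=> /(congr1 slmx); rewrite slmxSX /= mx22_scalar /dvdn.
have : (n %% 4 < 4)%N by rewrite ltn_mod.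
by case: (n %% 4)%N => [|[|[|[|//]]]] _ // /mx22_inj[].
Qed.

Lemma pm_id_powS M : pm_id M -> exists n, M = (slS ^+ n)%g.
Proof.
case=> ME; [exists 0%N | exists 2%N]; apply: val_inj; rewrite /= ME //.
by rewrite !mx22_mul mx22_N1.
Qed.

(** Multiplying on the left by A^-1 or B adds one row to the other; the diagonal
    entries stay at least 1, so the sum of the off-diagonal entries grows. *)
Lemma posword_mx w : exists a b c d,
  [/\ slmx (posword slA slB w) = mx22 a b c d,
      1 <= a, 1 <= d, 0 <= b /\ 0 <= c & (size w)%:Z <= b + c].
Proof.
elim: w => [|l w [a [b [c [d [wE a1 d1 [b0 c0] wbc]]]]]].
  by exists 1, 0, 0, 1; rewrite /posword big_nil /= mx22_scalar.
rewrite posword_cons slmxM wE.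
case: l; rewrite /letter ?slmx_invA /= mx22_mul !(mul0r, mul1r, addr0, add0r).
  by exists a, b, (a + c), (b + d); split=> //; lia.
by exists (a + c), (b + d), c, d; split=> //; lia.
Qed.

(** Among the four powers of S only the identity has a positive diagonal, and
    its off-diagonal entries vanish. *)
Lemma posword_powS w n : posword slA slB w = (slS ^+ n)%g -> w = [::].
Proof.
move=> /(congr1 slmx).
have [a [b [c [d [-> a1 d1 [b0 c0] wbc]]]]] := posword_mx w.
rewrite slmxSX => E; apply: size0nil; move: E.
have : (n %% 4 < 4)%N by rewrite ltn_mod.
by case: (n %% 4)%N => [|[|[|[|//]]]] _ /= /mx22_inj[]; lia.
Qed.

(** Left multiplication by a power of A or B adds a multiple of one row to the
    other, so the Euclidean algorithm on the first column, together with the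
    row exchange S, reaches a matrix whose lower left entry is 0. *)
Lemma SL2Z_generated M : generated [set slA; slB] M.
Proof.
set H := generated _; have sH : subgroup H := generated_subgroup _.
have HA : H slA by apply: sub_gen_smallest; left.
have HB : H slB by apply: sub_gen_smallest; right.
have Hcancel g N : H g -> H (g * N)%g -> H N.
  move=> Hg HgN; rewrite -(mulKg g N).
  by apply: (subgroupM sH) => //; apply: (subgroupV sH).
have HS : H slS.
  by rewrite /slS; apply: (subgroupM sH) => //; apply: (subgroupM sH).
have HT n N b : slmx N = mx22 1 b 0 1 -> (`|b| <= n)%N -> H N.
  have HT0 N' : slmx N' = mx22 1 0 0 1 -> H N'.
    move=> N'E; suff -> : N' = 1%g by exact: sH.1.
    by apply: val_inj; rewrite /= N'E mx22_scalar.
  elim: n N b => [|n IHn] N b NE bn.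
    by apply: HT0; rewrite NE; congr mx22; lia.
  have [b0|b0] := eqVneq b 0; first by apply: HT0; rewrite NE b0.
  have [bgt0|ble0] := ltrP 0 b.
    apply: (@Hcancel slA) => //; apply: (IHn _ (b - 1)); last by lia.
    by rewrite slmxM NE /= mx22_mul; congr mx22; ring.
  apply: (@Hcancel slA^-1%g); first exact: (subgroupV sH).
  apply: (IHn _ (b + 1)); last by lia.
  by rewrite slmxM NE slmx_invA /= mx22_mul; congr mx22; ring.
have HT' N a b d : slmx N = mx22 a b 0 d -> H N.
  move=> NE; have := eqP (valP N); rewrite /= NE det_mx22 mulr0 subr0 => ad1.
  (* When the diagonal is -1, the factor S^2 = -I makes it 1. *)
  have [[a1 d1]|[a1 d1]] : (a = 1 /\ d = 1) \/ (a = -1 /\ d = -1).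
  - have : (a %| 1)%Z by apply/dvdzP; exists d; rewrite mulrC.
    rewrite dvdz1; nia.
  - by apply: (@HT `|b|%N _ b) => //; rewrite NE a1 d1.
  apply: (@Hcancel (slS ^+ 2)%g); first exact: (subgroupM sH).
  apply: (@HT `|b|%N _ (- b)); last by lia.
  by rewrite slmxM slmxSX NE a1 d1 /= mx22_mul; congr mx22; ring.
have HE n N a b c d : slmx N = mx22 a b c d -> (`|a| + `|c| <= n)%N -> H N.
  elim: n N a b c d => [|n IHn] N a b c d NE acn.
    have c0 : c = 0 by lia.
    by apply: HT'; rewrite NE c0.
  have [c0|c0] := eqVneq c 0; first by apply: HT'; rewrite NE c0.
  have [a0|a0] := eqVneq a 0.
    apply: (@Hcancel slS) => //; apply: (HT' _ (- c) (- d) b).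
    by rewrite slmxM slmxS NE a0 mx22_mul; congr mx22; ring.
  have [ca|ac] := leP `|c|%N `|a|%N.
    have [ac0|ac0] := boolP ((0 < a) == (0 < c)).
      apply: (@Hcancel slA) => //.
      apply: (IHn _ (a - c) (b - d) c d); last by lia.
      by rewrite slmxM NE mx22_mul; congr mx22; ring.
    apply: (@Hcancel slA^-1%g); first exact: (subgroupV sH).
    apply: (IHn _ (a + c) (b + d) c d); last by lia.
    by rewrite slmxM NE slmx_invA mx22_mul; congr mx22; ring.
  have [ac0|ac0] := boolP ((0 < a) == (0 < c)).
    apply: (@Hcancel slB^-1%g); first exact: (subgroupV sH).
    apply: (IHn _ a b (c - a) (d - b)); last by lia.
    by rewrite slmxM NE slmx_invB mx22_mul; congr mx22; ring.
  apply: (@Hcancel slB) => //.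
  apply: (IHn _ a b (a + c) (b + d)); last by lia.
  by rewrite slmxM NE mx22_mul; congr mx22; ring.
by apply: HE (mx22_eta _) (leqnn _).
Qed.

End Matrices.

(** * Recognizing SL(2,Z) and PSL(2,Z) *)

(** The morphism q stands for the identity of SL(2,Z) or the projection to
    PSL(2,Z); both have their kernel inside <S>, so the word w of the normal
    form s^i w s^j evaluates to a power of S in SL(2,Z), hence is empty. *)
Lemma braided_kernel (G K : groupType) (a b s : G)
    (h : {multiplicative G -> K}) (q : {multiplicative SL2Z -> K}) x :
  a * b * a = s -> b * a * b = s -> s ^+ 4 = 1 ->
  generated [set a; b] x -> h a = q slA -> h b = q slB ->
  (forall M, q M = 1 -> exists n, M = slS ^+ n) ->
  h x = 1 -> exists2 n, x = s ^+ n & q (slS ^+ n) = 1.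
Proof.
move=> sA sB s4 gx hA hB qK.
have [i [w [j ->]]] := normal_formP sA sB s4 gx.
have hs : h s = q slS by rewrite -sA !gmulfM hA hB.
rewrite normal_form_morph hA hB hs -normal_form_morph => hx.
have [n] := qK _ hx; rewrite /normal_form => nfE.
have w0 : w = [::].
  (* The exponent is n - i - j modulo 4, as S^-1 = S^3. *)
  apply: (@posword_powS _ (3 * i + n + 3 * j)%N).
  have sVX k : slS ^+ (3 * k) = slS ^- k.
    by rewrite expgnA -(sV slS4) expVgn.
  rewrite (expgnDr _ (3 * i + n)) (expgnDr _ (3 * i)) !sVX -nfE.
  by rewrite !mulgA mulVg mul1g mulgK.
have nfs (L : groupType) (a' b' s' : L) :
    normal_form a' b' s' i w j = s' ^+ (i + j).
  by rewrite /normal_form w0 /posword big_nil mulg1 expgnDr.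
by exists (i + j)%N; [exact: nfs | rewrite -(nfs _ slA slB)].
Qed.

Lemma SL2Z_bijective (G : groupType) (a b s : G)
    (f : {multiplicative G -> SL2Z}) :
  a * b * a = s -> b * a * b = s -> s ^+ 4 = 1 ->
  (forall x, generated [set a; b] x) -> f a = slA -> f b = slB -> bijective f.
Proof.
move=> sA sB s4 gen fA fB.
apply: (bijective_of_generators (a := a) (b := b)) => [x fx|y].
  have [|n -> /slS_eq1/dvdnP[k ->]] :=
    braided_kernel (q := idfun) sA sB s4 (gen x) fA fB _ fx.
    by move=> M /= ->; exists 0.
  by rewrite mulnC expgnA s4 expg1n.
by rewrite fA fB; apply: SL2Z_generated.
Qed.

Lemma PSL2Z_bijective (G : groupType) (a b s : G)
    (f : {multiplicative G -> PSL2Z}) :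
  a * b * a = s -> b * a * b = s -> s ^+ 2 = 1 ->
  (forall x, generated [set a; b] x) -> f a = pslA -> f b = pslB -> bijective f.
Proof.
move=> sA sB s2 gen fA fB.
have s4 : s ^+ 4 = 1 by rewrite (expgnA s 2 2) s2 expg1n.
have projK M : qproj pm_id_subgroup M = 1 -> pm_id M.
  by move=> /esym/qprojP; rewrite invg1 mul1g.
apply: (bijective_of_generators (a := a) (b := b)) => [x fx|y].
  have [|n -> /projK/slS_pm_id en] :=
    braided_kernel (q := qproj pm_id_subgroup) sA sB s4 (gen x) fA fB _ fx.
    by move=> M /projK/pm_id_powS.
  by rewrite -(odd_double_half n) (negbTE en) -mul2n expgnA s2 expg1n.
rewrite fA fB -(qproj_repr y).
exact: (generated_morph (f := qproj pm_id_subgroup) (SL2Z_generated _)).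
Qed.

(** * Abelianization of braided two-generator groups *)

Section Abelianization.
Variables (G : groupType) (a b : G).
Hypotheses (braid : a * b * a = b * a * b).
Hypothesis gen : forall x, generated [set a; b] x.

Let p : {multiplicative G -> abelianization G} := qproj (derived_subgroup G).

Let p_surj c : exists x, p x = c.
Proof. by exists (repr c); apply: qproj_repr. Qed.

Let p_commute x y : commute (p x) (p y).
Proof.
rewrite /commute -!gmulfM; apply/qprojP.
apply: sub_gen_smallest; exists y, x.
by rewrite commgEl conjgE invgM !mulgA.
Qed.

Let p_braid : p b = p a.
Proof.
have := congr1 p braid; rewrite !gmulfM (p_commute b a) => /mulgI.
exact/esym.
Qed.

(** The relation on s bounds the order of the image of a from above, since the
    cube of that image is the image of s; the morphism chi bounds it from
    below. *)
Lemma cyclic_abelianization m (chi : {multiplicative G -> 'I_m.+1}) :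
  3 %| m.+1 -> (a * b * a) ^+ (m.+1 %/ 3) = 1 -> chi a = Zp1 ->
  cyclic_of_order (abelianization G) m.+1.
Proof.
move=> m3 sm chia.
have pm : p a ^+ m.+1 = 1.
  have := congr1 p sm; rewrite multiplicative1 multiplicativeX !gmulfM p_braid.
  have -> : p a * p a * p a = p a ^+ 3 by rewrite -mulgA.
  by rewrite -expgnA mulnC divnK.
have pmod k : p a ^+ (k %% m.+1) = p a ^+ k.
  by rewrite [in RHS](divn_eq k m.+1) expgnDr mulnC expgnA pm expg1n mul1g.
have powers c : exists2 k, k < m.+1 & c = p a ^+ k.
  have [x <-] := p_surj c.
  have [||| k ->] := generated2_ind (H := [set x | exists k, p x = p a ^+ k])
    _ _ _ (gen x).
  - split=> [|y z [k yE] [l zE]]; first by exists 0; rewrite multiplicative1.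
    (* The factor m stands for -1, as p a has exponent m.+1. *)
    exists (k + m * l)%N; rewrite multiplicativeF yE zE expgnDr; congr (_ * _).
    by apply: mulg1_eq; rewrite -expgnDr -mulSn expgnA pm expg1n.
  - by exists 1%N.
  - by exists 1%N; rewrite p_braid.
  - by exists (k %% m.+1); rewrite ?ltn_mod.
have [chi' chi'E] : exists f : {multiplicative abelianization G -> 'I_m.+1},
    forall x, f (p x) = chi x.
  apply: quotient_lift; apply: (smallest_sub (kernel_normal chi).1).
  move=> _ [x [y ->]]; rewrite /preimage /= multiplicativeR.
  by apply/eqP/commgP; apply: Zp_mulgC.
have chi'X k : chi' (p a ^+ k) = inZp k.
  rewrite multiplicativeX chi'E chia Zp_expg.
  by apply: val_inj; rewrite /= modnMml mul1n.
split.
  by exists (p a) => x; have [k _ ->] := powers x; exists k; left.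
have -> : [set: abelianization G] = (fun k => p a ^+ k) @` `I_m.+1.
  apply/seteqP; split=> // x _; have [k km ->] := powers x.
  by exists k.
apply: inj_card_eq => k l; rewrite !inE /= => km lm /(congr1 chi').
by rewrite !chi'X => /(congr1 val); rewrite /= !modn_small.
Qed.

End Abelianization.

(** * The presentations and the abelianizations *)

Lemma braid_cube (G : groupType) (a b : G) : a * b * a = b * a * b ->
  a * b * a * b * a * b = (a * b * a) ^+ 2.
Proof. by move=> sE; rewrite expg2 [X in _ = _ * X]sE !mulgA. Qed.

Section Relators.
Variables (G : groupType) (g : 'I_2 -> G).
Local Notation a := (g ord0).
Local Notation b := (g ord_max).

Lemma free_eval_braid :
  a * b * a = b * a * b -> free_eval g braid_relator = 1.
Proof.
move=> sE; rewrite /braid_relator !(gmulfM, multiplicativeV) /= !free_eval_gen.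
by rewrite sE mulgV.
Qed.

Lemma free_eval_s2 : a * b * a = b * a * b ->
  free_eval g (fa * fb * fa * fb * fa * fb) = (a * b * a) ^+ 2.
Proof.
move=> sE; rewrite !gmulfM /= !free_eval_gen.
exact: braid_cube.
Qed.

End Relators.

Section SL2ZPresentations.

Let slAB : slA * slB * slA = slB * slA * slB.
Proof. exact: esym slS_braid. Qed.

Let pslAB : pslA * pslB * pslA = pslB * pslA * pslB.
Proof. by have := congr1 (qproj pm_id_subgroup) slAB; rewrite !qprojM. Qed.

Let pslS2 : (pslA * pslB * pslA) ^+ 2 = 1.
Proof.
suff <- : qproj pm_id_subgroup (slS ^+ 2) = 1.
  by rewrite multiplicativeX !gmulfM.
apply/esym/qprojP; rewrite invg1 mul1g.
by right; rewrite (slmxSX 2) mx22_N1.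
Qed.

Lemma SL2Z_presentation : has_presentation
  [set braid_relator; (fa * fb * fa * fb * fa * fb) ^+ 2]
  (tnth [tuple slA; slB]).
Proof.
set R := [set _; _]; set g := tnth _.
have [|f fE] := presented_lift (g := g) (R := R).
  move=> r [->|->]; first exact: free_eval_braid.
  by rewrite multiplicativeX /= free_eval_s2 // -expgnA slS4.
have braid := presented_braid (R := R) (or_introl erefl).
exists f; split=> //.
apply: (SL2Z_bijective (erefl _) (esym braid) _ (presented_generated (R := R)));
  rewrite ?fE //.
have := presented_relator (R := R) (or_intror erefl).
rewrite multiplicativeX !gmulfM (expgnA _ 2 2) -(braid_cube braid).
by move=> s4; exact: s4.
Qed.

Lemma PSL2Z_presentation : has_presentation
  [set braid_relator; fa * fb * fa * fb * fa * fb] (tnth [tuple pslA; pslB]).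
Proof.
set R := [set _; _]; set g := tnth _.
have [|f fE] := presented_lift (g := g) (R := R).
  move=> r [->|->]; first exact: free_eval_braid.
  by rewrite free_eval_s2.
have braid := presented_braid (R := R) (or_introl erefl).
exists f; split=> //.
apply: (PSL2Z_bijective (erefl _) (esym braid) _
  (presented_generated (R := R))); rewrite ?fE //.
have := presented_relator (R := R) (or_intror erefl).
rewrite !gmulfM -(braid_cube braid).
by move=> s2; exact: s2.
Qed.

Lemma B3_quotient_SL2Z :
  exists f : {multiplicative quotient_group bs4_subgroup -> SL2Z},
    [/\ bijective f,
        f (qproj bs4_subgroup ba) = slA &
        f (qproj bs4_subgroup bb) = slB].
Proof.
have [|f0 f0E] := presented_lift (g := tnth [tuple slA; slB])
    (R := [set braid_relator]).
  by move=> r ->; apply: free_eval_braid.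
have f0a : f0 ba = slA by rewrite /ba f0E.
have f0b : f0 bb = slB by rewrite /bb f0E.
have [|f fE] := quotient_lift (N := bs4_subgroup) (f := f0).
  apply: (smallest_sub (kernel_normal f0).1) => _ ->.
  by rewrite /preimage /= multiplicativeX !gmulfM f0a f0b slS4.
exists f; rewrite !fE; split=> //.
pose q : {multiplicative B3 -> quotient_group bs4_subgroup} :=
  qproj bs4_subgroup.
have qs4 : q bs ^+ 4 = 1.
  rewrite -multiplicativeX; apply/esym/qprojP; rewrite invg1 mul1g.
  exact: sub_gen_smallest.
apply: (SL2Z_bijective (a := q ba) (b := q bb) _ _ qs4).
- by rewrite /bs !gmulfM.
- by rewrite bsE !gmulfM.
- move=> x; rewrite -(qproj_repr x).
  exact: (generated_morph (f := q)
    (presented_generated (R := [set _]) (repr x))).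
- by rewrite /= fE.
- by rewrite /= fE.
Qed.

Lemma SL2Z_abelianization : cyclic_of_order (abelianization SL2Z) 12.
Proof.
have [|chi chiE] :=
  presentation_lift (h := fun=> Zp1 : 'I_12) SL2Z_presentation.
  move=> r [->|->]; first exact: free_eval_braid.
  by rewrite multiplicativeX /= free_eval_s2 //; apply: val_inj.
exact: (cyclic_abelianization slAB SL2Z_generated (m := 11) _ slS4 (chiE ord0)).
Qed.

Lemma PSL2Z_abelianization : cyclic_of_order (abelianization PSL2Z) 6.
Proof.
have [|chi chiE] :=
  presentation_lift (h := fun=> Zp1 : 'I_6) PSL2Z_presentation.
  move=> r [->|->]; first exact: free_eval_braid.
  by rewrite free_eval_s2 //; apply: val_inj.
have gen x := presentation_generated x PSL2Z_presentation.
exact: (cyclic_abelianization pslAB gen (m := 5) _ pslS2 (chiE ord0)).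
Qed.

End SL2ZPresentations.

Theorem mainTheorem2 :
  [/\ has_presentation
        [set braid_relator; (fa * fb * fa * fb * fa * fb) ^+ 2]
        (tnth [tuple slA; slB]),
      has_presentation
        [set braid_relator; fa * fb * fa * fb * fa * fb]
        (tnth [tuple pslA; pslB]),
      exists f : {multiplicative quotient_group bs4_subgroup -> SL2Z},
        [/\ bijective f,
            f (qproj bs4_subgroup ba) = slA &
            f (qproj bs4_subgroup bb) = slB],
      cyclic_of_order (abelianization SL2Z) 12 &
      cyclic_of_order (abelianization PSL2Z) 6].
Proof.
split.
- exact: SL2Z_presentation.
- exact: PSL2Z_presentation.
- exact: B3_quotient_SL2Z.
- exact: SL2Z_abelianization.
- exact: PSL2Z_abelianization.
Qed.
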